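(* Let $p$ be a prime number. The category $\mathcal{SCF}_p$ of $p$-restricted strongly central series is action-representative, the universal action on an object $G_*$ being the canonical action of $\mathcal A_*(G_* )$ on $G_*$.
   Context: A strongly central series $G_*$ is a group $G=G_1$ with a filtration by subgroups $G_1\supseteq G_2\supseteq\cdots$ such that $[G_i,G_j]\subseteq G_{i+j}$ for all $i,j\geq1$; it is $p$-restricted if $g^p\in G_{pi}$ for all $i\ge1$ and $g\in G_i$. $\mathcal{SCF}$ is the category of strongly central series and filtration-preserving group morphisms, and $\mathcal{SCF}_p$ its full subcategory of $p$-restricted ones. In a homological category $\mathcal C$ (pointed, regular, protomodular), an action of $Z$ on $X$ is a split extension $X\hookrightarrow Y\twoheadrightarrow Z$ with a given splitting; $\mathrm{Act}(Z,X)$ denotes the set of actions of $Z$ on $X$ (up to isomorphism of split extensions inducing the identity on $X$ and $Z$), which is a contravariant functor in $Z$ via pullback. $\mathcal C$ is action-representative if $\mathrm{Act}(-,X)$ is representable for every object $X$; a universal action on $X$ is an action of a representing object $R$ on $X$ such that every action of any $Z$ on $X$ is its restriction along a unique morphism $Z\to R$. For $j\geq1$, $\mathcal A_j(G_* )=\{\sigma\in\mathrm{Aut}(G_* ):\forall i\geq1,\ \forall g\in G_i,\ \sigma(g)g^{-1}\in G_{i+j}\}$, where $\mathrm{Aut}(G_* )$ is the group of automorphisms $\sigma$ of $G_1$ with $\sigma(G_i)=G_i$ for all $i$. The canonical action of $\mathcal A_*(G_* )$ on $G_*$ is the split extension $G_*\hookrightarrow G_*\rtimes\mathcal A_*(G_*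 )\twoheadrightarrow\mathcal A_*(G_* )$, where the middle term is filtered by the subgroups $G_i\rtimes\mathcal A_i(G_* )$. *)

(* Defs.v *)
From HB Require Import structures.
#[warnings="-notation-overridden"]
From mathcomp Require Import all_boot.
From mathcomp Require Import boolp classical_sets.

Set Warnings "-redundant-canonical-projection".
Set Implicit Arguments.
Unset Strict Implicit.
Unset Printing Implicit Defensive.

Local Open Scope classical_set_scope.
Local Open Scope group_scope.

Record category := Category {
  ob :> Type;
  hom : ob -> ob -> Type;
  idm : forall X, hom X X;
  comp : forall X Y Z, hom Y Z -> hom X Y -> hom X Z;
  comp_idl : forall X Y (f : hom X Y), comp (idm Y) f = f;
  comp_idr : forall X Y (f : hom X Y), comp f (idm X) = f;
  compA : forall X Y Z W (f : hom Z W) (g : hom Y Z) (h : hom X Y),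
    comp f (comp g h) = comp (comp f g) h
}.

Arguments hom {c}.
Arguments idm {c}.
Arguments comp {c X Y Z}.

Notation "f \oc g" := (comp f g) (at level 40, left associativity).

Definition full_subcategory (C : category) (P : C -> Prop) : category :=
  @Category {X : C | P X} (fun X Y => hom (sval X) (sval Y))
    (fun X => idm (sval X)) (fun X Y Z f g => f \oc g)
    (fun X Y f => comp_idl f) (fun X Y f => comp_idr f)
    (fun X Y Z W f g h => compA f g h).

Section CategoryNotions.
Variable C : category.
Implicit Types X Y Z : C.

Definition is_iso X Y (f : hom X Y) :=
  exists g : hom Y X, g \oc f = idm X /\ f \oc g = idm Y.

Definition is_terminal Z := forall X, exists! f : hom X Z, True.
Definition is_initial Z := forall X, exists! f : hom Z X, True.
Definition is_zero_object Z := is_initial Z /\ is_terminal Z.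

Definition is_zero_morphism X Y (f : hom X Y) :=
  exists Z, is_zero_object Z /\
    exists (a : hom X Z) (b : hom Z Y), f = b \oc a.

Definition is_kernel X Y Z (k : hom X Y) (q : hom Y Z) :=
  is_zero_morphism (q \oc k) /\
  forall (T : C) (f : hom T Y), is_zero_morphism (q \oc f) ->
    exists! u : hom T X, k \oc u = f.

(*   P --b--> B   *)
(*   |a       |g  *)
(*   A --f--> S   *)
Definition is_pullback (P A B S : C) (a : hom P A) (b : hom P B)
    (f : hom A S) (g : hom B S) :=
  f \oc a = g \oc b /\
  forall (T : C) (u : hom T A) (v : hom T B), f \oc u = g \oc v ->
    exists! w : hom T P, a \oc w = u /\ b \oc w = v.

Definition is_coequalizer X Y Z (f g : hom X Y) (q : hom Y Z) :=
  q \oc f = q \oc g /\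
  forall (T : C) (u : hom Y T), u \oc f = u \oc g -> exists! v : hom Z T, v \oc q = u.

Definition is_regular_epi Y Z (q : hom Y Z) :=
  exists (X : C) (f g : hom X Y), is_coequalizer f g q.

Definition pointed := exists Z, is_zero_object Z.

Definition has_pullbacks :=
  forall (A B S : C) (f : hom A S) (g : hom B S),
    exists (P : C) (a : hom P A) (b : hom P B), is_pullback a b f g.

Definition regular :=
  [/\ exists Z, is_terminal Z,
      has_pullbacks,
      forall (P X Y : C) (f : hom X Y) (a b : hom P X), is_pullback a b f f ->
        exists (Z : C) (q : hom X Z), is_coequalizer a b q
    & forall (P A B S : C) (a : hom P A) (b : hom P B) (f : hom A S) (g : hom B S),
        is_pullback a b f g -> is_regular_epi f -> is_regular_epi b].

(* The change-of-base functors of the fibration of points (split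
   epimorphisms) reflect isomorphisms: [h] is a morphism from the point
   [(A1, p1, s1)] to the point [(A2, p2, s2)] over [B], and [h'] is the
   morphism it induces between the pullbacks of these points along [v]. *)
Definition protomodular :=
  forall (B B' : C) (v : hom B' B)
    (A1 : C) (p1 : hom A1 B) (s1 : hom B A1)
    (A2 : C) (p2 : hom A2 B) (s2 : hom B A2)
    (h : hom A1 A2)
    (A1' : C) (a1 : hom A1' A1) (p1' : hom A1' B')
    (A2' : C) (a2 : hom A2' A2) (p2' : hom A2' B') (h' : hom A1' A2'),
    p1 \oc s1 = idm B -> p2 \oc s2 = idm B ->
    p2 \oc h = p1 -> h \oc s1 = s2 ->
    is_pullback a1 p1' p1 v -> is_pullback a2 p2' p2 v ->
    a2 \oc h' = h \oc a1 -> p2' \oc h' = p1' ->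
    is_iso h' -> is_iso h.

Definition homological := [/\ pointed, regular & protomodular].

Record action Z X := Action {
  act_mid : C;
  act_ker : hom X act_mid;
  act_proj : hom act_mid Z;
  act_sec : hom Z act_mid;
  act_split : act_proj \oc act_sec = idm Z;
  act_kerP : is_kernel act_ker act_proj
}.

Definition action_iso Z X (E E' : action Z X) :=
  exists h : hom (act_mid E) (act_mid E'),
    [/\ is_iso h, h \oc act_ker E = act_ker E',
        act_proj E' \oc h = act_proj E & h \oc act_sec E = act_sec E'].

(* [E'] is the restriction of [E] along [g], i.e. (a choice of) the pullback
   of the split extension [E] along [g]. *)
Definition is_restriction Z Z' X (g : hom Z' Z) (E : action Z X)
    (E' : action Z' X) :=
  exists h : hom (act_mid E') (act_mid E),
    [/\ is_pullback h (act_proj E') (act_proj E) g,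
        h \oc act_sec E' = act_sec E \oc g &
        h \oc act_ker E' = act_ker E].

(* Elements of [Act Z X] are isomorphism classes of actions. *)
Definition Act Z X :=
  {A : action Z X -> Prop | exists E, A = action_iso E}.

(* The action of [Act -, X] on morphisms, at the level of sets of actions: all
   the restrictions along [g] of the members of [A]. When pullbacks exist, it
   maps isomorphism classes to isomorphism classes. *)
Definition restrict Z Z' X (g : hom Z' Z) (A : action Z X -> Prop) :
    action Z' X -> Prop :=
  fun E' => exists2 E, A E & is_restriction g E E'.

Definition represents_Act X R :=
  exists phi : forall Z, hom Z R -> Act Z X,
    (forall Z, bijective (@phi Z)) /\
    (forall Z Z' (g : hom Z' Z) (f : hom Z R),
      sval (phi Z' (f \oc g)) = restrict g (sval (phi Z f))).

Definition universal_action X R (U : action R X) :=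
  represents_Act X R /\
  forall Z (E : action Z X), exists! f : hom Z R, is_restriction f U E.

(* The notion only makes sense for homological categories, hence the first
   conjunct. *)
Definition action_representative :=
  homological /\ forall X, exists R, represents_Act X R.

End CategoryNotions.

Record is_subgroup (G : groupType) (A : set G) : Prop := IsSubgroup {
  subgroup1 : A 1;
  subgroupM : forall x y, A x -> A y -> A (x * y);
  subgroupV : forall x, A x -> A x^-1
}.

Definition commutator_subgroup (G : groupType) (A B : set G) : set G :=
  [set z | forall H : set G, is_subgroup H ->
     (forall x y, A x -> B y -> H [~ x, y]) -> H z].

(* Only the indices [i >= 1] are meaningful: [fil 0] is unconstrained and is
   never used. *)
Record scseries := SCSeries {
  carrier :> groupType;
  fil : nat -> set carrier;
  fil_subgroup : forall i, 0 < i -> is_subgroup (fil i);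
  fil1 : fil 1 = setT;
  fil_decr : forall i, 0 < i -> fil i.+1 `<=` fil i;
  fil_comm : forall i j, 0 < i -> 0 < j ->
    commutator_subgroup (fil i) (fil j) `<=` fil (i + j)
}.

Definition p_restricted (p : nat) (G : scseries) :=
  forall i, 0 < i -> forall g : G, fil i g -> fil (p * i)%N (g ^+ p).

Record scmorphism (G H : scseries) := SCMorphism {
  scfun :> G -> H;
  scfunM : {morph scfun : x y / x * y};
  scfun_fil : forall i, 0 < i -> forall x, fil i x -> fil i (scfun x)
}.

Lemma scmorphism_eq (G H : scseries) (f g : scmorphism G H) : f =1 g -> f = g.
Proof.
case: f g => [f fM fF] [g gM gF] /= /funext fg; subst g.
by congr SCMorphism; exact: Prop_irrelevance.
Qed.

Definition sc_id (G : scseries) : scmorphism G G.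
Proof. by exists id. Defined.

Definition sc_comp (G H K : scseries) (f : scmorphism H K)
  (g : scmorphism G H) : scmorphism G K.
Proof.
exists (f \o g) => [x y|i i0 x xi] /=; first by rewrite !scfunM.
by do 2 apply: scfun_fil => //.
Defined.

Definition SCF : category.
Proof.
by exists scseries scmorphism sc_id sc_comp => *; exact: scmorphism_eq.
Defined.

Definition SCFp (p : nat) : category :=
  @full_subcategory SCF (p_restricted p).

Section SCSeriesTheory.
Variable G : scseries.
Implicit Types x y : G.

Lemma filT x : fil 1 x. Proof. by rewrite fil1. Qed.

Lemma fil_le i j : 0 < i -> i <= j -> fil (s:=G) j `<=` fil i.
Proof.
move=> i0 /subnKC <-; elim: (j - i) => [|n IHn] x; first by rewrite addn0.
by rewrite addnS => xS; apply/IHn/fil_decr; rewrite ?addn_gt0 ?i0.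
Qed.

Lemma fil_commg i j x y :
  0 < i -> 0 < j -> fil i x -> fil j y -> fil (i + j) [~ x, y].
Proof. by move=> i0 j0 xi yj; apply: fil_comm => // H _; apply. Qed.

Lemma fil_1 i : 0 < i -> fil i (1 : G).
Proof. by case/(@fil_subgroup G _). Qed.

Lemma fil_M i x y : 0 < i -> fil i x -> fil i y -> fil i (x * y).
Proof. by case/(@fil_subgroup G _) => _ + _; apply. Qed.

Lemma fil_V i x : 0 < i -> fil i x -> fil i x^-1.
Proof. by case/(@fil_subgroup G _) => _ _; apply. Qed.

Lemma fil_J i x y : 0 < i -> fil i x -> fil i (x ^ y).
Proof.
move=> i0 xi; have -> : x ^ y = x * [~ x, y] by rewrite /commg mulgA mulgV mul1g.
apply: fil_M => //; apply: (@fil_le _ (i + 1)); rewrite ?leq_addr//.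
by apply: fil_commg => //; exact: filT.
Qed.

End SCSeriesTheory.

Record filtered_aut (G : scseries) := FilteredAut {
  aut_fun :> G -> G;
  aut_funM : {morph aut_fun : x y / x * y};
  aut_bij : bijective aut_fun;
  aut_fil : forall i, 0 < i -> aut_fun @` fil i = fil i
}.

HB.instance Definition _ (G : scseries) := gen_eqMixin (filtered_aut G).
HB.instance Definition _ (G : scseries) := gen_choiceMixin (filtered_aut G).

Section FilteredAut.
Variable G : scseries.
Implicit Types s t : filtered_aut G.

Lemma filtered_aut_eq s t : s =1 t -> s = t.
Proof.
case: s t => [s sM sB sF] [t tM tB tF] /= /funext st; subst t.
by congr FilteredAut; exact: Prop_irrelevance.
Qed.

Lemma aut_fun_fil s i x : 0 < i -> fil i x -> fil i (s x).
Proof. by move=> i0 xi; rewrite -(aut_fil s i0); exists x. Qed.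

Definition aut_one : filtered_aut G.
Proof. by exists id => // [|i _]; [exists id | rewrite image_id]. Defined.

Definition aut_mul s t : filtered_aut G.
Proof.
exists (s \o t) => [x y||i i0]; first by rewrite /= !aut_funM.
- by apply: bij_comp; exact: aut_bij.
- by rewrite -image_comp !aut_fil.
Defined.

Lemma aut_inv_subproof s : {g | cancel s g /\ cancel g s}.
Proof. by apply: cid; case: (aut_bij s) => g sg gs; exists g. Qed.

Let inv_fun s := sval (aut_inv_subproof s).

Lemma inv_funK s : cancel s (inv_fun s).
Proof. exact: (svalP (aut_inv_subproof s)).1. Qed.

Lemma inv_funKV s : cancel (inv_fun s) s.
Proof. exact: (svalP (aut_inv_subproof s)).2. Qed.

Definition aut_inv s : filtered_aut G.
Proof.
exists (inv_fun s) => [x y||i i0].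
- by apply: (can_inj (inv_funK s)); rewrite aut_funM !inv_funKV.
- by exists s; [exact: inv_funKV | exact: inv_funK].
- apply/seteqP; split => [_ [x + <-]|x xi].
    by rewrite -{1}(aut_fil s i0) => -[y yi <-]; rewrite inv_funK.
  by exists (s x); [exact: aut_fun_fil | rewrite inv_funK].
Defined.

Lemma aut_mulA : associative aut_mul.
Proof. by move=> *; exact: filtered_aut_eq. Qed.

Lemma aut_mul1 : left_id aut_one aut_mul.
Proof. by move=> *; exact: filtered_aut_eq. Qed.

Lemma aut_mulr1 : right_id aut_one aut_mul.
Proof. by move=> *; exact: filtered_aut_eq. Qed.

Lemma aut_mulV : left_inverse aut_one aut_inv aut_mul.
Proof. by move=> s; apply: filtered_aut_eq => x; exact: inv_funK. Qed.

Lemma aut_mulrV : right_inverse aut_one aut_inv aut_mul.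
Proof. by move=> s; apply: filtered_aut_eq => x; exact: inv_funKV. Qed.

HB.instance Definition _ := isGroup.Build (filtered_aut G)
  aut_mulA aut_mul1 aut_mulr1 aut_mulV aut_mulrV.

Lemma autM s t x : (s * t) x = s (t x). Proof. by []. Qed.
Lemma aut1 x : (1 : filtered_aut G) x = x. Proof. by []. Qed.
Lemma autVK s : cancel s s^-1.
Proof. by move=> x; rewrite -autM mulVg. Qed.
Lemma autKV s : cancel s^-1 s.
Proof. by move=> x; rewrite -autM mulgV. Qed.
Lemma aut_fun1 s : s 1 = 1.
Proof. by apply: (mulgI (s 1)); rewrite -aut_funM !mulg1. Qed.
Lemma aut_funV s x : s x^-1 = (s x)^-1.
Proof. by apply: (mulgI (s x)); rewrite -aut_funM !mulgV aut_fun1. Qed.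

Definition Afil (j : nat) : set (filtered_aut G) :=
  [set s | forall i, 0 < i -> forall g : G, fil i g -> fil (i + j) (s g * g^-1)].

Lemma Afil_subgroup j : is_subgroup (Afil j).
Proof.
have ij i : 0 < i -> 0 < i + j by move=> i0; rewrite addn_gt0 i0.
split=> [i i0 g gi|s t sj tj i i0 g gi|s sj i i0 g gi].
- by rewrite aut1 mulgV; apply: fil_1; exact: ij.
- have -> : (s * t) g * g^-1 = (s (t g) * (t g)^-1) * (t g * g^-1).
    by rewrite autM mulgA mulgVK.
  apply: fil_M; [exact: ij | apply: sj => //; exact: aut_fun_fil | exact: tj].
- have -> : s^-1 g * g^-1 = s^-1 (s g * g^-1)^-1.
    by rewrite invgM invgK aut_funM aut_funV autVK.
  by apply/aut_fun_fil/fil_V; rewrite ?ij//; exact: sj.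
Qed.

Lemma Afil_decr i : Afil i.+1 `<=` Afil i.
Proof.
move=> s si k k0 g gk; apply: fil_decr; first by rewrite addn_gt0 k0.
by rewrite -addnS; exact: si.
Qed.

Lemma Afil_commg i j s t : Afil i s -> Afil j t -> Afil (i + j) [~ s, t].
Proof.
move=> si tj k k0 g gk.
have p0 n : 0 < k + n by rewrite addn_gt0 k0.
set a := s g * g^-1; set b := t g * g^-1.
have ai : fil (k + i) a by exact: si.
have bj : fil (k + j) b by exact: tj.
have sg : s g = a * g by rewrite mulgVK.
have tg : t g = b * g by rewrite mulgVK.
have -> : [~ s, t] g * g^-1 = (t * s)^-1 (s (t g) * (t (s g))^-1).
  rewrite aut_funM aut_funV -(autM t s) autVK; congr (_ * _).
  by rewrite -!autM /commg /conjg invgM !mulgA.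
apply: aut_fun_fil; first exact: p0.
have -> : s (t g) * (t (s g))^-1 =
   (s b * b^-1) * [~ b^-1, a^-1] * (t a * a^-1)^-1.
  rewrite sg tg !aut_funM sg tg /commg /conjg !invgM !invgK !mulgA.
  by rewrite !(mulgVK, mulgK).
apply: fil_M; [exact: p0 | apply: fil_M; first exact: p0 |].
- by rewrite (addnC i) addnA; exact: si.
- apply: (@fil_le _ _ ((k + j) + (k + i))); first exact: p0.
    by rewrite addnACA leq_add// ?leq_addr// addnC.
  by apply: fil_commg; rewrite ?p0//; apply: fil_V; rewrite ?p0.
- by apply: fil_V; [exact: p0 | rewrite addnA; exact: tj].
Qed.

End FilteredAut.

Record A1_type (G : scseries) := A1Type {
  A1_val :> filtered_aut G;
  A1_valP : Afil 1 A1_val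
}.

HB.instance Definition _ (G : scseries) := gen_eqMixin (A1_type G).
HB.instance Definition _ (G : scseries) := gen_choiceMixin (A1_type G).

Section ASeries.
Variable G : scseries.
Implicit Types s t : A1_type G.

Lemma A1_val_inj : injective (@A1_val G).
Proof.
move=> [s sP] [t tP] /= st; subst t.
by congr A1Type; exact: Prop_irrelevance.
Qed.

Definition A1_one : A1_type G := A1Type (subgroup1 (Afil_subgroup G 1)).
Definition A1_mul s t : A1_type G :=
  A1Type (subgroupM (Afil_subgroup G 1) (A1_valP s) (A1_valP t)).
Definition A1_inv s : A1_type G :=
  A1Type (subgroupV (Afil_subgroup G 1) (A1_valP s)).

Lemma A1_mulA : associative A1_mul.
Proof. by move=> *; apply: A1_val_inj; exact: mulgA. Qed.
Lemma A1_mul1 : left_id A1_one A1_mul.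
Proof. by move=> *; apply: A1_val_inj; exact: mul1g. Qed.
Lemma A1_mulr1 : right_id A1_one A1_mul.
Proof. by move=> *; apply: A1_val_inj; exact: mulg1. Qed.
Lemma A1_mulV : left_inverse A1_one A1_inv A1_mul.
Proof. by move=> *; apply: A1_val_inj; exact: mulVg. Qed.
Lemma A1_mulrV : right_inverse A1_one A1_inv A1_mul.
Proof. by move=> *; apply: A1_val_inj; exact: mulgV. Qed.

HB.instance Definition _ := isGroup.Build (A1_type G)
  A1_mulA A1_mul1 A1_mulr1 A1_mulV A1_mulrV.

(* A_*(G): its underlying group, the first term, is A_1(G), not Aut(G). *)
Definition A_series : scseries.
Proof.
exists (A1_type G) (fun j => [set s | Afil j (A1_val s)]).
- move=> j _; have [? M V] := Afil_subgroup G j.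
  by split=> // [x y|x] /=; [exact: M | exact: V].
- by apply/seteqP; split=> // s _; exact: A1_valP.
- by move=> i _ s; exact: Afil_decr.
- move=> i j i0 j0 s; apply.
    have [? M V] := Afil_subgroup G (i + j).
    by split=> // [x y|x] /=; [exact: M | exact: V].
  by move=> x y xi yj; exact: Afil_commg.
Defined.

End ASeries.

Record sd_type (G : scseries) := SD { sd_l : G; sd_r : A_series G }.

HB.instance Definition _ (G : scseries) := gen_eqMixin (sd_type G).
HB.instance Definition _ (G : scseries) := gen_choiceMixin (sd_type G).

Section Semidirect.
Variable G : scseries.
Implicit Types x y : sd_type G.

Definition aut_of (s : A_series G) : filtered_aut G := A1_val s.

Definition sd_one : sd_type G := SD 1 1.
Definition sd_mul x y : sd_type G :=
  SD (sd_l x * aut_of (sd_r x) (sd_l y)) (sd_r x * sd_r y).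
Definition sd_inv x : sd_type G :=
  SD (aut_of (sd_r x)^-1 (sd_l x)^-1) (sd_r x)^-1.

Lemma sd_mulA : associative sd_mul.
Proof.
by move=> [g s] [h t] [k u]; rewrite /sd_mul /= aut_funM !mulgA.
Qed.
Lemma sd_mul1 : left_id sd_one sd_mul.
Proof. by move=> [g s]; rewrite /sd_mul !mul1g. Qed.
Lemma sd_mulr1 : right_id sd_one sd_mul.
Proof. by move=> [g s]; rewrite /sd_mul aut_fun1 !mulg1. Qed.
Lemma sd_mulV : left_inverse sd_one sd_inv sd_mul.
Proof.
by move=> [g s]; congr SD; [rewrite -[LHS]aut_funM mulVg aut_fun1 | exact: mulVg].
Qed.
Lemma sd_mulrV : right_inverse sd_one sd_inv sd_mul.
Proof.
move=> [g s]; congr SD; last exact: mulgV.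
by rewrite /= (autKV (aut_of s)) mulgV.
Qed.

HB.instance Definition _ := isGroup.Build (sd_type G)
  sd_mulA sd_mul1 sd_mulr1 sd_mulV sd_mulrV.

Definition sd_fil (i : nat) : set (sd_type G) :=
  [set x | fil i (sd_l x) /\ fil i (sd_r x)].

Lemma sd_fil_subgroup i : 0 < i -> is_subgroup (sd_fil i).
Proof.
move=> i0; split=> [|x y [xl xr] [yl yr]|x [xl xr]].
- by split; exact: fil_1.
- by split; apply: fil_M => //; exact: aut_fun_fil.
- by split; [apply: aut_fun_fil => //|]; exact: fil_V.
Qed.

Lemma sd_fil_commg i j x y :
  0 < i -> 0 < j -> sd_fil i x -> sd_fil j y -> sd_fil (i + j) [~ x, y].
Proof.
move=> i0 j0; case: x y => [g s] [h t] [/= gi si] [/= hj tj].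
have ij0 : 0 < i + j by rewrite addn_gt0 i0.
have -> : [~ SD g s, SD h t] = (SD h t * SD g s)^-1 * (SD g s * SD h t).
  by rewrite /commg /conjg invgM !mulgA.
have sdE : (SD h t * SD g s)^-1 * (SD g s * SD h t) =
    SD (aut_of (t * s)^-1 ((h * aut_of t g)^-1 * (g * aut_of s h)))
       ((t * s)^-1 * (s * t)).
  by congr SD; rewrite [RHS]aut_funM.
rewrite {}sdE; split; last first.
  change (fil (i + j) ((t * s)^-1 * (s * t))).
  have -> : (t * s)^-1 * (s * t) = [~ s, t].
    by rewrite /commg /conjg invgM !mulgA.
  exact: fil_commg.
apply: (aut_fun_fil (aut_of (t * s)^-1) ij0).
have -> : (h * aut_of t g)^-1 * (g * aut_of s h) =
    ((aut_of t g * g^-1)^-1 ^ g) * [~ g, h] * ((aut_of s h * h^-1) ^ h).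
  rewrite /commg /conjg !invgM !invgK !mulgA mulVg mul1g.
  by rewrite !(mulgVK, mulgK).
have sh : fil (i + j) (aut_of s h * h^-1) by rewrite addnC; exact: si.
have tg : fil (i + j) (aut_of t g * g^-1) by exact: tj.
apply: fil_M => //; last exact: fil_J.
apply: fil_M => //; last exact: fil_commg.
by apply: fil_J => //; exact: fil_V.
Qed.

Definition semidirect : scseries.
Proof.
exists (sd_type G) sd_fil.
- exact: sd_fil_subgroup.
- by apply/seteqP; split=> // x _; split; exact: filT.
- by move=> i i0 x [xl xr]; split; exact: fil_decr.
- move=> i j i0 j0 x; apply; first by apply: sd_fil_subgroup; rewrite addn_gt0 i0.
  by move=> *; exact: sd_fil_commg.
Defined.

Definition can_ker : scmorphism G semidirect.
Proof.
exists (fun g => SD g 1 : semidirect) => [g h|i i0 g gi].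
  by congr SD; rewrite mulg1.
by split=> //; exact: fil_1.
Defined.

Definition can_proj : scmorphism semidirect (A_series G).
Proof. by exists (@sd_r G) => // i i0 x []. Defined.

Definition can_sec : scmorphism (A_series G) semidirect.
Proof.
exists (fun s => SD 1 s : semidirect) => [s t|i i0 s si].
  by congr SD; rewrite /= aut_fun1 mulg1.
by split=> //; exact: fil_1.
Defined.

End Semidirect.

Record triv_type := Triv {}.

Lemma triv_eq (x y : triv_type) : x = y. Proof. by case: x y => [] []. Qed.

HB.instance Definition _ := gen_eqMixin triv_type.
HB.instance Definition _ := gen_choiceMixin triv_type.
HB.instance Definition _ := isGroup.Build triv_type
  (mul := fun _ _ => Triv) (one := Triv) (inv := fun _ => Triv)
  (fun _ _ _ => triv_eq _ _) (fun _ => triv_eq _ _) (fun _ => triv_eq _ _)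
  (fun _ => triv_eq _ _) (fun _ => triv_eq _ _).

Definition triv_series : scseries.
Proof. by exists triv_type (fun=> setT). Defined.

Lemma scfun1 (G H : scseries) (f : scmorphism G H) : f 1 = 1.
Proof. by apply: (mulgI (f 1)); rewrite -scfunM !mulg1. Qed.

Definition sc_const1 (G H : scseries) : scmorphism G H.
Proof. by exists (fun=> 1) => [x y|i i0 x _]; [rewrite mulg1 | exact: fil_1]. Defined.

Section CanonicalAction.
Variable p : nat.

Definition SCFp_obj (G : scseries) (hG : p_restricted p G) : SCFp p :=
  exist _ (G : SCF) hG.

Lemma triv_p_restricted : p_restricted p triv_series.
Proof. by []. Qed.

Lemma triv_zero_object : is_zero_object (SCFp_obj triv_p_restricted).
Proof.
split=> X.
- exists (sc_const1 triv_series (sval X)); split=> // f _.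
  by apply: scmorphism_eq => x; rewrite (triv_eq x 1) [RHS]scfun1.
- exists (sc_const1 (sval X) triv_series); split=> // f _.
  by apply: scmorphism_eq => x; exact: triv_eq.
Qed.

Lemma zero_morphismP (X Y : SCFp p) (f : scmorphism (sval X) (sval Y)) :
  is_zero_morphism (f : hom X Y) <-> forall x, f x = 1.
Proof.
split=> [[Z [[Zi _] [a [b ->]]]] x|f1].
- have [u [_ uP]] := Zi Z.
  have uid := uP (idm Z) I.
  have u1 := uP (sc_const1 (sval Z) (sval Z)) I.
  have az1 : (a : scmorphism _ _) x = 1.
    by have := congr1 (fun h : scmorphism _ _ => h (a x)) (etrans (esym uid) u1).
  by rewrite /= az1 scfun1.
- exists (SCFp_obj triv_p_restricted); split; first exact: triv_zero_object.
  exists (sc_const1 (sval X) triv_series), (sc_const1 triv_series (sval Y)).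
  by apply: scmorphism_eq => x; exact: f1.
Qed.

Section Canonical.
Variable G : SCFp p.
Hypothesis hA : p_restricted p (A_series (sval G)).
Hypothesis hS : p_restricted p (semidirect (sval G)).

Lemma canonical_split :
  comp (c := SCFp p) (X := SCFp_obj hA) (Y := SCFp_obj hS) (Z := SCFp_obj hA)
    (can_proj (sval G)) (can_sec (sval G)) = idm (SCFp_obj hA).
Proof. exact: scmorphism_eq. Qed.

Lemma canonical_kernel :
  is_kernel (C := SCFp p) (X := G) (Y := SCFp_obj hS) (Z := SCFp_obj hA)
    (can_ker (sval G)) (can_proj (sval G)).
Proof.
split=> [|T f /zero_morphismP qf1]; first exact/zero_morphismP.
have fr x : sd_r (f x) = 1 by exact: qf1.
have u : {u : scmorphism (sval T) (sval G) | forall x, u x = sd_l (f x)}.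
  have uM : {morph (fun x => sd_l (f x)) : x y / x * y}.
    by move=> x y; rewrite scfunM /= fr.
  by exists (SCMorphism uM (fun i i0 x xi => (scfun_fil f i0 xi).1)).
exists (sval u); split=> [|v vf]; apply: scmorphism_eq => x.
- change (SD (sval u x) 1 = f x); rewrite (svalP u) -(fr x).
  by case: (f x).
- by rewrite (svalP u) -vf.
Qed.

Definition canonical_action : action (SCFp_obj hA) G :=
  Action canonical_split canonical_kernel.

End Canonical.
End CanonicalAction.

(* Main.v *)
(** Let [G] be [p]-restricted, [s] in [A_j(G)] and [h] in [G_m] with [j <= m].
    The orbit [n |-> s^n(h)] is a polynomial sequence in the sense of Leibman:
    each difference raises the degree of its values by [j]. Hence so is the norm
    [N(n) = h s(h) ... s^(n-1)(h)], whose Taylor expansion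
    [N(p) = \prod_k c_k ^ 'C(p, k)] shows, since [p] divides ['C(p, k)] for
    [0 < k < p], that [N(p)] lies in [G_(m + (p-1)j)]. In the semidirect product
    [(h s)^n = N(n) s^n], so that [A_*(G)] and its semidirect product with [G]
    are [p]-restricted.

    In a pointed category with pullbacks, an action of which every action is
    uniquely a restriction represents [Act(-, X)]. The canonical action is such:
    an action of [Z] on [G], with splitting [s], is its restriction along
    [z |-> (g |-> s(z) g s(z)^-1)] only, because in the split extension [Y] the
    kernel has the induced filtration and [[Y_j, Y_i]] lies in [Y_(i + j)]. *)

Require Import Defs.
From HB Require Import structures.
#[warnings="-notation-overridden"]
From mathcomp Require Import all_boot.
From mathcomp Require Import boolp classical_sets.

Set Warnings "-redundant-canonical-projection".
Set Implicit Arguments.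
Unset Strict Implicit.
Unset Printing Implicit Defensive.

Local Open Scope classical_set_scope.
Local Open Scope group_scope.

(** * Polynomial sequences and restrictedness *)

(** Unlike for [fil], the index starts at 0 and [F 0] may be a proper subgroup of [G]. *)
Record central_filtration (G : groupType) (F : nat -> set G) : Prop :=
  CentralFiltration {
  cf_subgroup : forall r, is_subgroup (F r);
  cf_decr : forall r, F r.+1 `<=` F r;
  cf_comm : forall r s x y, F r x -> F s y -> F (r + s)%N [~ x, y]
}.

Section CentralFiltration.
Variables (G : groupType) (F : nat -> set G).
Hypothesis hF : central_filtration F.

Lemma cf_le r s : r <= s -> F s `<=` F r.
Proof.
move=> /subnKC <-; elim: (s - r) => [|n IHn] x; first by rewrite addn0.
by rewrite addnS => /(cf_decr hF); exact: IHn.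
Qed.

Lemma cf_1 r : F r 1. Proof. by case: (cf_subgroup hF r). Qed.
Lemma cf_M r x y : F r x -> F r y -> F r (x * y).
Proof. by case: (cf_subgroup hF r) => _ + _; apply. Qed.
Lemma cf_V r x : F r x -> F r x^-1.
Proof. by case: (cf_subgroup hF r) => _ _; apply. Qed.
Lemma cf_X r x n : F r x -> F r (x ^+ n).
Proof.
by move=> xr; elim: n => [|n IHn]; [exact: cf_1 | rewrite expgS; exact: cf_M].
Qed.
Lemma cf_J r s x y : F r x -> F s y -> F r (x ^ y).
Proof.
move=> xr ys; have -> : x ^ y = x * [~ x, y] by rewrite commgEl mulVKg.
by apply: cf_M => //; apply: cf_le (cf_comm hF xr ys); exact: leq_addr.
Qed.

Section Derived.
Variable S : G -> G.
Hypothesis SM : {morph S : x y / x * y}.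
Hypothesis SF : forall r x, F r x -> F r (S x).

(** With [S] the shift on sequences, this adds one condition on differences; iterating it gives
    Leibman's polynomial sequences. *)
Definition derived_filtration (r : nat) : set G :=
  [set x | F r x /\ F r.+1 (x^-1 * S x)].

Let S1 : S 1 = 1. Proof. by apply: (mulgI (S 1)); rewrite -SM !mulg1. Qed.
Let SV x : S x^-1 = (S x)^-1.
Proof. by apply: (mulgI (S x)); rewrite -SM !mulgV S1. Qed.

(** The inductive step of the Lazard-Leibman theorem that polynomial sequences form a group. *)
Lemma derived_filtration_central : central_filtration derived_filtration.
Proof.
split=> [r|r x [xr dxr]|r s x y [xr]].
- split=> [|x y [xr dxr] [yr dyr]|x [xr dxr]].
  + by split; rewrite ?S1 ?mulVg; exact: cf_1.
  + split; first exact: cf_M.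
    have -> : (x * y)^-1 * S (x * y) = (x^-1 * S x) ^ y * (y^-1 * S y).
      by rewrite SM invgM conjgE !mulgA mulgK.
    by apply: cf_M => //; exact: cf_J yr.
  + split; first exact: cf_V.
    have -> : x^-1^-1 * S x^-1 = (x^-1 * S x)^-1 ^ x^-1.
      by rewrite SV conjgE invgM !invgK !mulgA mulgK.
    by apply: cf_J (cf_V xr); exact: cf_V.
- by split; exact: (cf_decr hF).
- set u := x^-1 * S x => ur [ys]; set v := y^-1 * S y => vs.
  split; first exact: (cf_comm hF).
  have Sx : S x = x * u by rewrite mulVKg.
  have Sy : S y = y * v by rewrite mulVKg.
  (* The outer factors gain a degree by replacing [y] with [v] or [x] with [u]; the middle one gains
     it because [u * v] lies in [F 1]. *)
  have -> : [~ x, y]^-1 * S [~ x, y] =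
      [~ x * u, v] ^ [~ x, y] * ([~ [~ x, y], u * v] * [~ u, y] ^ v).
    rewrite [S _](_ : _ = [~ S x, S y]); last by rewrite /commg /conjg !SM !SV.
    rewrite Sx Sy /commg /conjg !invgM !invgK !mulgA.
    by rewrite !(mulgVK, mulgK, mulVg, mul1g).
  have ur0 : F r u by exact: (cf_decr hF).
  apply: cf_M; last apply: cf_M.
  + apply: cf_J (cf_comm hF xr ys); rewrite -addnS.
    by apply: (cf_comm hF) => //; exact: cf_M.
  + have uv : F 1 (u * v) by apply: cf_M; [apply: cf_le ur | apply: cf_le vs].
    by rewrite -addn1; apply: (cf_comm hF) => //; exact: (cf_comm hF).
  + by apply: cf_J vs; rewrite -addSn; exact: (cf_comm hF).
Qed.

Lemma derived_filtration_stable r x :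
  derived_filtration r x -> derived_filtration r (S x).
Proof. by move=> [xr dxr]; split; [exact: SF | rewrite -SV -SM; exact: SF]. Qed.

End Derived.
End CentralFiltration.

(** * Sequences in a group, differences and Taylor expansion *)

Definition seqg (G : groupType) := nat -> G.

Section SeqGroup.
Variable G : groupType.
Implicit Types f g : seqg G.

HB.instance Definition _ := gen_eqMixin (seqg G).
HB.instance Definition _ := gen_choiceMixin (seqg G).

Lemma seqg_mulA : associative (fun f g : seqg G => (fun n => f n * g n) : seqg G).
Proof. by move=> f g h; apply/funext => n; exact: mulgA. Qed.
Lemma seqg_mul1 :
  left_id ((fun=> 1) : seqg G) (fun f g => (fun n => f n * g n) : seqg G).
Proof. by move=> f; apply/funext => n; exact: mul1g. Qed.
Lemma seqg_mulr1 :
  right_id ((fun=> 1) : seqg G) (fun f g => (fun n => f n * g n) : seqg G).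
Proof. by move=> f; apply/funext => n; exact: mulg1. Qed.
Lemma seqg_mulV : left_inverse ((fun=> 1) : seqg G)
  (fun f => (fun n => (f n)^-1) : seqg G)
  (fun f g => (fun n => f n * g n) : seqg G).
Proof. by move=> f; apply/funext => n; exact: mulVg. Qed.
Lemma seqg_mulrV : right_inverse ((fun=> 1) : seqg G)
  (fun f => (fun n => (f n)^-1) : seqg G)
  (fun f g => (fun n => f n * g n) : seqg G).
Proof. by move=> f; apply/funext => n; exact: mulgV. Qed.

HB.instance Definition _ := isGroup.Build (seqg G)
  seqg_mulA seqg_mul1 seqg_mulr1 seqg_mulV seqg_mulrV.

Definition shift f : seqg G := fun n => f n.+1.
Definition diff f : seqg G := f^-1 * shift f.

Lemma diffE f n : diff f n = (f n)^-1 * f n.+1. Proof. by []. Qed.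

(** While earlier values are trivial, the inverse factor in [diffE] disappears and a difference is a
    mere shift. At [i = n], [j = 0] this reads [f n] off as an [n]-th difference. *)
Lemma iter_diff_vanishing f n i j : (forall l, l < n -> f l = 1) ->
  (i + j <= n)%N -> iter i diff f j = f (i + j)%N.
Proof.
move=> f1; elim: i j => [//|i IHi] j ijn.
rewrite iterS diffE !IHi ?addnS -?addSn//; last exact: ltnW.
by rewrite f1// invg1 mul1g.
Qed.

Definition binomial_seq (c : G) (k : nat) : seqg G := fun n => c ^+ 'C(n, k).

Section PolySeq.
Variable F : nat -> set G.
Hypothesis hF : central_filtration F.

(* The sequences all of whose differences of order [k <= d] take their values
   in [F (r + k)]. *)
Fixpoint poly_seq (d : nat) : nat -> set (seqg G) :=
  if d is d'.+1 then derived_filtration (poly_seq d') shift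
  else fun r => [set f | forall n, F r (f n)].

(** One induction serves both claims: centrality at [d.+1] uses stability under [shift] at [d]. *)
Lemma poly_seq_central_stable d : central_filtration (poly_seq d) /\
  forall r f, poly_seq d r f -> poly_seq d r (shift f).
Proof.
elim: d => [|d [IHc IHs]] /=; last first.
  split; first exact: derived_filtration_central.
  by move=> r f; exact: derived_filtration_stable.
split=> [|r f fr n]; last exact: fr.
split=> [r|r f fr n|r s f g fr gs n].
- split=> [n|f g fr gr n|f fr n].
  + exact: cf_1.
  + exact: cf_M.
  + exact: cf_V.
- exact: (cf_decr hF).
- exact: (cf_comm hF).
Qed.

Lemma poly_seq_central d : central_filtration (poly_seq d).
Proof. exact: (poly_seq_central_stable d).1. Qed.

Lemma poly_seq_iter_diff d r f k n :
  poly_seq d r f -> (k <= d)%N -> F (r + k)%N (iter k diff f n).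
Proof.
elim: d r f k n => [|d IHd] r f [|k] n //=.
- by rewrite addn0 => fr _; exact: fr.
- by case=> /IHd /(_ (leq0n d)).
- by case=> _ dfr kd; rewrite -iterS iterSr addnS -addSn; exact: IHd.
Qed.

(** By Pascal's rule a difference lowers [k] by one while [r] rises by one, so [r + k] is
    unchanged. *)
Lemma poly_seq_binomial d r k c :
  F (r + k)%N c -> poly_seq d r (binomial_seq c k).
Proof.
elim: d r k => [|d IHd] r k ck /=.
  by move=> n; apply: (cf_X hF); apply: (cf_le hF) ck; exact: leq_addr.
split; first exact: IHd.
rewrite -/(diff _); case: k ck => [|k] ck.
  have -> : diff (binomial_seq c 0) = 1.
    by apply/funext => n; rewrite diffE /binomial_seq !bin0 mulVg.
  exact: (cf_1 (poly_seq_central d)).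
have -> : diff (binomial_seq c k.+1) = binomial_seq c k.
  by apply/funext => n; rewrite diffE /binomial_seq binS expgnDr mulKg.
by apply: IHd; rewrite addSn -addnS.
Qed.

(* By the Taylor expansion [f n = \prod_k c_k ^+ 'C(n, k)] with [c_k] in
   [F k]: at [n = p], the exponents are divisible by [p] for [0 < k < p]. *)
Lemma poly_seq_prime p f : prime p ->
  (forall i c, 0 < i -> F i c -> F p (c ^+ p)) ->
  poly_seq p 0 f -> f 0%N = 1 -> F p (f p).
Proof.
move=> pr_p Fp fp f0.
(* The sequence [g] is [f] stripped of its Taylor terms of order at most [k], which alters the value
   at [p] only modulo [F p]. For [k = p.-1], [g p] is the [p]-th difference of [g] at 0. *)
suff H k : (k < p)%N -> exists2 g : seqg G,
    poly_seq p 0 g /\ F p (g p * (f p)^-1) & forall l, (l <= k)%N -> g l = 1.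
  have [//|g [gp gfp] g1] := H p.-1; first by rewrite prednK// prime_gt0.
  have gpp : F p (g p).
    rewrite -{2}[p](addn0 p) -(@iter_diff_vanishing g p p 0) ?addn0//.
      by rewrite -{1}[p]add0n; exact: poly_seq_iter_diff gp _.
    by move=> l lp; apply: g1; rewrite -ltnS prednK// prime_gt0.
  rewrite -[f p]invgK; apply: (cf_V hF).
  rewrite -[X in F p X](mulKg (g p)); apply: (cf_M hF) => //.
  exact: (cf_V hF).
elim: k => [|k IHk] kp.
  exists f => [|l]; last by rewrite leqn0 => /eqP ->.
  by split=> //; rewrite mulgV; exact: cf_1.
have [g [gp gfp] g1] := IHk (ltnW kp).
(* As [g] is trivial up to [k], [g k.+1] is its difference of order [k.+1] at 0. *)
have ck : F k.+1 (g k.+1)^-1.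
  apply: (cf_V hF).
  rewrite -{2}[k.+1](addn0 k.+1) -(@iter_diff_vanishing g k.+1 k.+1 0) ?addn0//.
  by rewrite -{1}[k.+1]add0n; apply: poly_seq_iter_diff gp _; exact: ltnW.
set c := (g k.+1)^-1 in ck.
exists (binomial_seq c k.+1 * g) => [|l]; last first.
  move=> lk1; rewrite -[LHS]/(c ^+ 'C(l, k.+1) * g l).
  move: lk1; rewrite leq_eqVlt => /predU1P[->|lk].
    by rewrite binn expg1 mulVg.
  by rewrite bin_small// g1// mulg1.
split.
  by apply: (cf_M (poly_seq_central p)) => //; exact: poly_seq_binomial.
rewrite -[(_ * g) p]/(c ^+ 'C(p, k.+1) * g p) -mulgA; apply: (cf_M hF) => //.
have /dvdnP[q ->] : p %| 'C(p, k.+1) by apply: prime_dvd_bin => //; rewrite kp.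
by rewrite mulnC expgnA; apply: (cf_X hF); exact: Fp ck.
Qed.

End PolySeq.
End SeqGroup.

(** * Norms of automorphisms and [p]-restrictedness *)

Section RestrictedAut.
Variables (p : nat) (G : scseries).
Hypotheses (pr_p : prime p) (hG : p_restricted p G).

Definition orbit_seq (s : filtered_aut G) (h : G) : seqg G :=
  fun n => (s ^+ n) h.

Definition aut_norm (s : filtered_aut G) (h : G) : seqg G :=
  fun n => \prod_(l < n) (s ^+ l) h.

Lemma aut_norm_fil m j (s : filtered_aut G) h : 0 < j -> (j <= m)%N ->
  Afil j s -> fil m h -> fil (m + p.-1 * j) (aut_norm s h p).
Proof.
move=> j0 jm sj hm.
have m0 : 0 < m by exact: leq_trans j0 jm.
have mj0 k : 0 < m + k by rewrite addn_gt0 m0.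
(* Truncated subtraction gives [F 0 = F 1 = fil m], while [F p] is the target. The orbit of [h] has
   degree 1, so the norm, whose difference it is, has degree 0. Degrees of commutators add up
   because [j <= m]. *)
pose F (k : nat) : set G := fil (m + k.-1 * j)%N.
have hF : central_filtration F.
  split=> [r|r x|r t x y xr yt].
  - exact: fil_subgroup.
  - apply: fil_le => //; rewrite leq_add2l leq_mul2r; apply/orP; right.
    by case: r.
  - apply: (fil_le _ _ (fil_commg (mj0 _) (mj0 _) xr yt)) => //.
    rewrite addnACA -mulnDl -addnA leq_add2l.
    apply: leq_trans (leq_add jm (leqnn _)); rewrite -mulSn leq_mul2r.
    apply/orP; right; case: r t {xr yt} => [|r] [|t] //=.
    by rewrite addnS.
(* The difference of an orbit is the orbit of [h'^-1 * s h'], which lies [j] deeper in [G], hence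
   one step deeper in [F]. The index is positive because [F 1] gains nothing over [F 0]. *)
have sF d : forall r h', F r.+1 h' -> poly_seq F d r.+1 (orbit_seq s h').
  elim: d => [|d IHd] r h' h'r /=.
    rewrite /orbit_seq; elim=> [|n IHn]; first by rewrite expg0.
    by rewrite expgS; exact: aut_fun_fil.
  split; [exact: IHd | rewrite -/(diff _)].
  have -> : diff (orbit_seq s h') = orbit_seq s (h'^-1 * s h').
    apply/funext => n.
    by rewrite diffE /orbit_seq aut_funM aut_funV -autM -expgSr.
  apply: IHd.
  have -> : h'^-1 * s h' = (s h' * h'^-1) ^ h' by rewrite conjgE mulgVK.
  by apply: fil_J => //; rewrite /F /= mulSn addnCA addnC; exact: sj.
have nF d : poly_seq F d 0 (aut_norm s h).
  elim: d => [|d IHd] /=.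
    move=> n; rewrite /F /= mul0n addn0 /aut_norm.
    elim/big_ind: _ => [|x y|l _]; [exact: fil_1 | exact: fil_M |].
    exact: aut_fun_fil.
  split; [exact: IHd | rewrite -/(diff _)].
  have -> : diff (aut_norm s h) = orbit_seq s h.
    by apply/funext => n; rewrite diffE /aut_norm big_ord_recr mulKg.
  by apply: sF; rewrite /F mul0n addn0.
apply: (poly_seq_prime hF pr_p) (nF p) _; last by rewrite /aut_norm big_ord0.
(* The bound [p * (m + i.-1 * j) >= m + p.-1 * j] follows from [j <= m]. *)
move=> i c i0 ci; apply: fil_le (hG _ ci) => //.
rewrite mulnDr -{2}(prednK (prime_gt0 pr_p)) mulSn -addnA leq_add2l.
apply: leq_trans (leq_addr _ _); rewrite leq_mul2l jm orbT.
by [].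
Qed.

(** The product telescopes: its [l]-th factor is the inverse of [(s ^+ l) g] times
    [(s ^+ l.+1) g]. *)
Lemma autX_norm (s : filtered_aut G) g n :
  (s ^+ n) g = g * aut_norm s (g^-1 * s g) n.
Proof.
elim: n => [|n IHn]; first by rewrite /aut_norm big_ord0 mulg1.
rewrite /aut_norm big_ord_recr mulgA -/(aut_norm _ _ n) -IHn /=.
by rewrite aut_funM aut_funV mulVKg -autM -expgSr.
Qed.

(** Taking [m = i + j] in [aut_norm_fil] meets [j <= m] for every [i] and yields degree
    [i + j + (p - 1) j = i + p j]. *)
Lemma Afil_X j (s : filtered_aut G) : 0 < j -> Afil j s -> Afil (p * j) (s ^+ p).
Proof.
move=> j0 sj i i0 g gi.
rewrite autX_norm; set N := aut_norm _ _ _.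
have -> : g * N * g^-1 = N ^ g^-1 by rewrite conjgE invgK mulgA.
rewrite -[p in (p * j)%N](prednK (prime_gt0 pr_p)) mulSn addnA.
have ij0 : 0 < i + j by rewrite addn_gt0 i0.
apply: fil_J; first by rewrite addn_gt0 ij0.
apply: aut_norm_fil => //; first exact: leq_addl.
have -> : g^-1 * s g = (s g * g^-1) ^ g by rewrite conjgE mulgVK.
by apply: fil_J => //; exact: sj.
Qed.

Lemma A_series_p_restricted : p_restricted p (A_series G).
Proof.
move=> j j0 s sj; rewrite [fil _ _]/(Afil _ _).
have -> : A1_val (s ^+ p) = A1_val s ^+ p.
  by elim: p => [//|n IHn]; rewrite !expgS -IHn.
exact: Afil_X.
Qed.

Lemma sd_X (x : semidirect G) n :
  x ^+ n = SD (aut_norm (aut_of (sd_r x)) (sd_l x) n) (sd_r x ^+ n).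
Proof.
elim: n => [|n IHn]; first by rewrite /aut_norm big_ord0.
rewrite expgSr IHn /aut_norm big_ord_recr expgSr; congr (SD (_ * _) _).
by elim: n {IHn} => [//|n IHn]; rewrite !expgS /= -IHn.
Qed.

(** The first component is a norm with [m = j = i], of degree [i + (p - 1) i = p i]. *)
Lemma semidirect_p_restricted : p_restricted p (semidirect G).
Proof.
move=> i i0 x [xl xr]; rewrite sd_X; split; last exact: A_series_p_restricted.
rewrite /= -[p in (p * i)%N](prednK (prime_gt0 pr_p)) mulSn.
exact: aut_norm_fil.
Qed.
End RestrictedAut.

(** * Actions in a category *)

Section Categories.
Variable C : category.
Implicit Types X Y Z : C.

Lemma zero_morphism_uniq X Y (f g : hom X Y) :
  is_zero_morphism f -> is_zero_morphism g -> f = g.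
Proof.
move=> [Z [[Zi Zt] [a [b ->]]]] [Z' [[Zi' Zt'] [a' [b' ->]]]].
(* The two morphisms may factor through different zero objects, which [c] compares. *)
have [c _] := Zi Z'.
have [? [_ ta]] := Zt' X; have [? [_ ib]] := Zi Y.
have ca : c \oc a = a' by rewrite -[LHS](ta _ I); exact: ta.
have bc : b' \oc c = b by rewrite -[LHS](ib _ I); exact: ib.
by rewrite -ca -bc Defs.compA.
Qed.

Lemma zero_morphism_compl X Y Z (f : hom X Y) (g : hom Y Z) :
  is_zero_morphism f -> is_zero_morphism (g \oc f).
Proof.
move=> [O [O0 [a [b ->]]]]; exists O; split=> //.
by exists a, (g \oc b); rewrite Defs.compA.
Qed.

Lemma zero_morphism_compr X Y Z (f : hom X Y) (g : hom Y Z) :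
  is_zero_morphism g -> is_zero_morphism (g \oc f).
Proof.
move=> [O [O0 [a [b ->]]]]; exists O; split=> //.
by exists (a \oc f), b; rewrite Defs.compA.
Qed.

Lemma pointed_zero_morphism : pointed C ->
  forall X Y, exists f : hom X Y, is_zero_morphism f.
Proof.
move=> [O O0] X Y; have [Oi Ot] := O0.
have [a _] := Ot X; have [b _] := Oi Y.
by exists (b \oc a), O; split=> //; exists a, b.
Qed.

Lemma pullback_inj (P A B S : C) (a : hom P A) (b : hom P B)
    (f : hom A S) (g : hom B S) : is_pullback a b f g ->
  forall T (u v : hom T P), a \oc u = a \oc v -> b \oc u = b \oc v -> u = v.
Proof.
move=> [fg univ] T u v auv buv.
have [|w [_ wu]] := univ T (a \oc v) (b \oc v); first by rewrite !Defs.compA fg.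
by rewrite -(wu u (conj auv buv)) (wu v).
Qed.

Lemma action_ker_zero Z X (E : action Z X) :
  is_zero_morphism (act_proj E \oc act_ker E).
Proof. exact: (act_kerP E).1. Qed.

Lemma action_iso_sym Z X (E E' : action Z X) : action_iso E E' -> action_iso E' E.
Proof.
move=> [h [[h' [h'h hh']] hk hp hs]]; exists h'; split.
- by exists h.
- by rewrite -hk Defs.compA h'h comp_idl.
- by rewrite -hp -Defs.compA hh' comp_idr.
- by rewrite -hs Defs.compA h'h comp_idl.
Qed.

Lemma is_restriction_id Z X (E E' : action Z X) :
  is_restriction (idm Z) E E' <-> action_iso E' E.
Proof.
split=> [[h [hpb hs hk]]|[h [[h' [h'h hh']] hk hp hs]]].
- have [hp univ] := hpb.
  (* The inverse of [h] is the map into the pullback induced by the identity and [act_proj E]. *)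
  have [|h' [[hh' ph'] _]] := univ _ (idm _) (act_proj E).
    by rewrite comp_idl comp_idr.
  exists h; split=> //.
  + exists h'; split=> //; apply: (pullback_inj hpb).
      by rewrite Defs.compA hh' comp_idl comp_idr.
    by rewrite Defs.compA ph' comp_idr hp comp_idl.
  + by rewrite hp comp_idl.
  + by rewrite hs comp_idr.
- exists h; split=> //; last by rewrite comp_idr.
  split=> [|T u v]; first by rewrite comp_idl.
  rewrite comp_idl => uv; exists (h' \oc u); split.
    by rewrite Defs.compA hh' comp_idl -hp -Defs.compA [h \oc _]Defs.compA hh'
      comp_idl uv.
  by move=> w [<- _]; rewrite Defs.compA h'h comp_idl.
Qed.

(** Pasting of pullback squares. *)
Lemma is_restriction_comp Z Z' Z'' X (f : hom Z' Z) (g : hom Z'' Z')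
    (U : action Z X) E E' :
  is_restriction f U E -> is_restriction g E E' -> is_restriction (f \oc g) U E'.
Proof.
move=> [h [hpb hs hk]] [h' [hpb' hs' hk']].
have [hp univ] := hpb; have [hp' univ'] := hpb'.
exists (h \oc h'); split.
- split=> [|T u v uv]; first by rewrite Defs.compA hp -Defs.compA hp' Defs.compA.
  have [|w [[hw pw] wu]] := univ T u (g \oc v); first by rewrite uv Defs.compA.
  have [|w' [[hw' pw'] wu']] := univ' T w v; first by rewrite pw.
  exists w'; split; first by rewrite -Defs.compA hw'.
  move=> w2 [hw2 pw2]; apply: wu'; split=> //; apply/esym/wu.
  by rewrite Defs.compA hw2 Defs.compA hp' -Defs.compA pw2.
- by rewrite -Defs.compA hs' [LHS]Defs.compA hs Defs.compA.
- by rewrite -Defs.compA hk'.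
Qed.

(** The converse half of pasting: [h'] factors through [h], and the joint monicity of the
    projections of the pullback carries over the splitting and the kernel. *)
Lemma is_restriction_cancel Z Z' Z'' X (f : hom Z' Z) (g : hom Z'' Z')
    (U : action Z X) E E' :
  is_restriction f U E -> is_restriction (f \oc g) U E' -> is_restriction g E E'.
Proof.
move=> [h [hpb hs hk]] [h' [hpb' hs' hk']].
have [hp univ] := hpb; have [hp' univ'] := hpb'.
have [|k [[hk2 pk] ku]] := univ _ h' (g \oc act_proj E').
  by rewrite hp' Defs.compA.
exists k; split.
- split=> // T u v uv.
  have [|w [[hw pw] wu]] := univ' T (h \oc u) v.
    by rewrite Defs.compA hp -Defs.compA uv Defs.compA.
  exists w; split.
    split=> //; apply: (pullback_inj hpb); first by rewrite Defs.compA hk2.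
    by rewrite Defs.compA pk -Defs.compA pw uv.
  by move=> w2 [kw2 pw2]; apply: wu; rewrite -kw2 Defs.compA hk2.
- apply: (pullback_inj hpb).
    by rewrite Defs.compA hk2 hs' [RHS]Defs.compA hs Defs.compA.
  by rewrite !Defs.compA pk -Defs.compA !act_split comp_idl comp_idr.
- apply: (pullback_inj hpb); first by rewrite Defs.compA hk2 hk' hk.
  rewrite Defs.compA pk -Defs.compA; apply: zero_morphism_uniq;
    last exact: action_ker_zero.
  by apply: zero_morphism_compl; exact: action_ker_zero.
Qed.

(** The kernel stays [X]: its inclusion into the pullback is induced by [act_ker E] and the zero
    morphism to [Z']. *)
Lemma is_restriction_exists Z Z' X (g : hom Z' Z) (E : action Z X) :
  pointed C -> has_pullbacks C -> exists E', is_restriction g E E'.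
Proof.
move=> C0 /(_ _ _ _ (act_proj E) g) [P [a [b Ppb]]].
have [fg univ] := Ppb.
have [|s [[as_ bs] _]] := univ _ (act_sec E \oc g) (idm Z').
  by rewrite Defs.compA act_split comp_idl comp_idr.
have [o o0] := pointed_zero_morphism C0 X Z'.
have [|k [[ak bk] _]] := univ _ (act_ker E) o.
  apply: zero_morphism_uniq; first exact: action_ker_zero.
  exact: zero_morphism_compl.
have kP : is_kernel k b.
  split=> [|T f bf0]; first by rewrite bk.
  have [|u [ku uu]] := (act_kerP E).2 T (a \oc f).
    by rewrite Defs.compA fg -Defs.compA; exact: zero_morphism_compl.
  exists u; split.
    apply: (pullback_inj Ppb); first by rewrite Defs.compA ak.
    apply: zero_morphism_uniq => //; rewrite Defs.compA bk.
    exact: zero_morphism_compr.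
  by move=> v kv; apply: uu; rewrite -ak -Defs.compA kv.
by exists (Action bs kP), a.
Qed.

(** A morphism is sent to the set of restrictions of [U] along it, a full isomorphism class.
    Surjectivity comes from existence in the hypothesis, injectivity from uniqueness, and naturality
    from pasting. *)
Lemma universal_represents X R (U : action R X) :
  pointed C -> has_pullbacks C ->
  (forall Z (E : action Z X), exists! f : hom Z R, is_restriction f U E) ->
  represents_Act X R.
Proof.
move=> C0 Cpb univ.
have clP Z (f : hom Z R) E : is_restriction f U E ->
    is_restriction f U = action_iso E.
  move=> fE; apply/funext => E'; apply/propext; split=> [fE'|EE'].
    apply/is_restriction_id; apply: is_restriction_cancel fE' _.
    by rewrite comp_idr.
  rewrite -[f]comp_idr; apply: is_restriction_comp fE _.
  by apply/is_restriction_id/action_iso_sym.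
have cl Z (f : hom Z R) : exists E, is_restriction f U = action_iso E.
  have [E fE] := is_restriction_exists f U C0 Cpb.
  by exists E; exact: clP.
exists (fun Z f => exist _ (is_restriction f U) (cl Z f)).
split=> [Z|Z Z' g f] /=.
  have lift (A : Act Z X) : {f : hom Z R | is_restriction f U = sval A}.
    apply: cid; have [E ->] := svalP A.
    by have [f [/clP fE _]] := univ Z E; exists f.
  exists (fun A => sval (lift A)) => [f|A].
    have fE := svalP (lift (exist _ (is_restriction f U) (cl Z f))).
    have [E EP] := is_restriction_exists f U C0 Cpb.
    (* Both [f] and the morphism chosen for its class restrict [U] to [E], so both equal [f0]. *)
    have [f0 [_ f0u]] := univ Z E.
    apply: etrans (f0u f EP); apply/esym/f0u.
    exact: (eq_ind_r (fun A => A E) EP fE).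
  apply: eq_sig_hprop; last exact: (svalP (lift A)).
  by move=> *; exact: Prop_irrelevance.
apply/funext => E'; apply/propext; split=> [fgE'|[E fE gE]].
  have [E fE] := is_restriction_exists f U C0 Cpb.
  by exists E => //; exact: is_restriction_cancel fE fgE'.
exact: is_restriction_comp fE gE.
Qed.

End Categories.

(** * [SCFp] is homological *)

(** Here [F 1] may be a proper subgroup of [H]; [cs_series] takes it as underlying group. Fibre
    products and images are built this way. *)
Record central_series (H : groupType) (F : nat -> set H) : Prop := CentralSeries {
  cs_subgroup : forall i, 0 < i -> is_subgroup (F i);
  cs_decr : forall i, 0 < i -> F i.+1 `<=` F i;
  cs_comm : forall i j x y, 0 < i -> 0 < j ->
    F i x -> F j y -> F (i + j)%N [~ x, y]
}.

Record cs_type (H : groupType) (F : nat -> set H) (hF : central_series F) :=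
  CSElt { cs_val :> H; cs_valP : F 1%N cs_val }.

HB.instance Definition _ H F (hF : @central_series H F) :=
  gen_eqMixin (cs_type hF).
HB.instance Definition _ H F (hF : @central_series H F) :=
  gen_choiceMixin (cs_type hF).

Section CSSeries.
Variables (H : groupType) (F : nat -> set H) (hF : central_series F).
Implicit Types x y : cs_type hF.

Lemma cs_val_inj : injective (@cs_val H F hF).
Proof.
move=> [x xP] [y yP] /= xy; subst y.
by congr CSElt; exact: Prop_irrelevance.
Qed.

Let hF1 := cs_subgroup hF (ltn0Sn 0).
Definition cs_one : cs_type hF := CSElt hF (subgroup1 hF1).
Definition cs_mul x y : cs_type hF :=
  CSElt hF (subgroupM hF1 (cs_valP x) (cs_valP y)).
Definition cs_inv x : cs_type hF := CSElt hF (subgroupV hF1 (cs_valP x)).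

Lemma cs_mulA : associative cs_mul.
Proof. by move=> *; apply: cs_val_inj; exact: mulgA. Qed.
Lemma cs_mul1 : left_id cs_one cs_mul.
Proof. by move=> *; apply: cs_val_inj; exact: mul1g. Qed.
Lemma cs_mulr1 : right_id cs_one cs_mul.
Proof. by move=> *; apply: cs_val_inj; exact: mulg1. Qed.
Lemma cs_mulV : left_inverse cs_one cs_inv cs_mul.
Proof. by move=> *; apply: cs_val_inj; exact: mulVg. Qed.
Lemma cs_mulrV : right_inverse cs_one cs_inv cs_mul.
Proof. by move=> *; apply: cs_val_inj; exact: mulgV. Qed.

HB.instance Definition _ := isGroup.Build (cs_type hF)
  cs_mulA cs_mul1 cs_mulr1 cs_mulV cs_mulrV.

Lemma cs_fil_subgroup i : 0 < i -> is_subgroup [set x : cs_type hF | F i x].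
Proof.
move=> /(cs_subgroup hF) [F1 FM FV].
by split=> [|x y|x] /=; [exact: F1 | exact: FM | exact: FV].
Qed.

Definition cs_series : scseries.
Proof.
exists (cs_type hF) (fun i => [set x | F i (cs_val x)]).
- exact: cs_fil_subgroup.
- by apply/seteqP; split=> // x _; exact: cs_valP.
- by move=> i i0 x; exact: (cs_decr hF).
- move=> i j i0 j0 x; apply; first by apply: cs_fil_subgroup; rewrite addn_gt0 i0.
  by move=> y z yi zj; exact: (cs_comm hF i0 j0 yi zj).
Defined.

Lemma cs_series_p_restricted p :
  (forall i (x : H), 0 < i -> F i x -> F (p * i)%N (x ^+ p)) ->
  p_restricted p cs_series.
Proof.
move=> Fp i i0 x xi; have {}xi := Fp i (cs_val (x : cs_type hF)) i0 xi.
change (F (p * i)%N (cs_val (x ^+ p : cs_type hF))).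
suff -> : cs_val (x ^+ p : cs_type hF) = cs_val (x : cs_type hF) ^+ p by [].
by elim: p {Fp xi} => [//|n IHn]; rewrite !expgS -IHn.
Qed.

End CSSeries.

Lemma scfunV (G H : scseries) (f : scmorphism G H) x : f x^-1 = (f x)^-1.
Proof. by apply: (mulgI (f x)); rewrite -scfunM !mulgV scfun1. Qed.

Lemma scfunX (G H : scseries) (f : scmorphism G H) x n : f (x ^+ n) = f x ^+ n.
Proof. by elim: n => [|n IHn]; rewrite ?scfun1// !expgS scfunM IHn. Qed.

Lemma scfunR (G H : scseries) (f : scmorphism G H) x y :
  f [~ x, y] = [~ f x, f y].
Proof. by rewrite /commg /conjg !scfunM !scfunV. Qed.

(** * Fibre products of strongly central series *)

Section FibreProduct.
Variables (p : nat) (A B S : scseries).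
Variables (f : scmorphism A S) (g : scmorphism B S).

Definition fp_fil (i : nat) : set (A * B)%type :=
  [set z | [/\ fil i z.1, fil i z.2 & f z.1 = g z.2]].

Lemma fp_central_series : central_series fp_fil.
Proof.
split=> [i i0|i i0 z [z1 z2 fg]|i j z w i0 j0 [z1 z2 zfg] [w1 w2 wfg]].
- split=> [|z w [z1 z2 zfg] [w1 w2 wfg]|z [z1 z2 zfg]].
  + by split; rewrite ?scfun1; [exact: fil_1 | exact: fil_1 |].
  + by split; rewrite ?scfunM ?zfg ?wfg//; exact: fil_M.
  + by split; rewrite ?scfunV ?zfg//; exact: fil_V.
- by split=> //; exact: fil_decr.
- by split; rewrite /= ?scfunR ?zfg ?wfg//; exact: fil_commg.
Qed.

Definition fp_series := cs_series fp_central_series.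

Lemma fp_series_p_restricted :
  p_restricted p A -> p_restricted p B -> p_restricted p fp_series.
Proof.
move=> hA hB; apply: cs_series_p_restricted => i z i0 [z1 z2 zfg].
have -> : z ^+ p = (z.1 ^+ p, z.2 ^+ p).
  by elim: p => [//|n IHn]; rewrite !expgS IHn.
by split; rewrite /= ?scfunX ?zfg//; [exact: hA | exact: hB].
Qed.

Definition fp_fst : scmorphism fp_series A.
Proof. by exists (fun z : fp_series => (cs_val z).1) => // i i0 z []. Defined.
Definition fp_snd : scmorphism fp_series B.
Proof. by exists (fun z : fp_series => (cs_val z).2) => // i i0 z []. Defined.

Lemma fp_eq z : f (fp_fst z) = g (fp_snd z).
Proof. by have [] := cs_valP z. Qed.

Definition fp_mk x y (xy : f x = g y) : fp_series :=
  CSElt fp_central_series (And3 (filT x) (filT y) xy : fp_fil 1 (x, y)).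

Definition fp_pair (T : scseries) (u : scmorphism T A) (v : scmorphism T B)
  (uv : forall t, f (u t) = g (v t)) : scmorphism T fp_series.
Proof.
exists (fun t => fp_mk (uv t)) => [s t|i i0 t ti].
  by apply: cs_val_inj; rewrite /= !scfunM.
by split; [exact: scfun_fil | exact: scfun_fil | exact: uv].
Defined.

End FibreProduct.

(** * Images of filtered morphisms *)

Section Image.
Variables (p : nat) (A S : scseries) (f : scmorphism A S).

(** The quotient filtration coming from [A], in general smaller than the one induced by [S]. *)
Definition im_fil (i : nat) : set S := f @` fil i.

Lemma im_central_series : central_series im_fil.
Proof.
split=> [i i0|i i0 _ [x xi <-]|i j _ _ i0 j0 [x xi <-] [y yj <-]].
- split=> [|_ _ [x xi <-] [y yi <-]|_ [x xi <-]].
  + by exists 1; [exact: fil_1 | exact: scfun1].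
  + by exists (x * y); [exact: fil_M | exact: scfunM].
  + by exists x^-1; [exact: fil_V | exact: scfunV].
- by exists x => //; exact: fil_decr.
- by exists [~ x, y]; [exact: fil_commg | exact: scfunR].
Qed.

Definition im_series := cs_series im_central_series.

Lemma im_series_p_restricted : p_restricted p A -> p_restricted p im_series.
Proof.
move=> hA; apply: cs_series_p_restricted => i _ i0 [x xi <-].
by exists (x ^+ p); [exact: hA | exact: scfunX].
Qed.

Definition im_proj : scmorphism A im_series.
Proof.
exists (fun x => CSElt im_central_series (imageP f (filT x)) : im_series).
- by move=> x y; apply: cs_val_inj; exact: scfunM.
- by move=> i i0 x xi; exists x.
Defined.

Definition im_incl : scmorphism im_series S.
Proof.
exists (fun y : im_series => cs_val y) => // i i0 y [x xi <-].
exact: scfun_fil.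
Defined.

End Image.

(** * Regularity and protomodularity, by elementwise criteria *)

Section SCFp.
Variable p : nat.

Lemma hom_eqE (X Y : SCFp p) (f g : scmorphism (sval X) (sval Y)) :
  f = g :> hom X Y -> f =1 g.
Proof. by move=> ->. Qed.

(** The map from the explicit fibre product [Q] to [P] preserves degrees, which gives the lifting
    condition. Conversely, lifting in degree 1 defines the mediating map, joint injectivity makes it
    a morphism, and lifting in degree [i] makes it filtered. *)
Lemma pullbackP (P A B S : SCFp p)
    (a : scmorphism (sval P) (sval A)) (b : scmorphism (sval P) (sval B))
    (f : scmorphism (sval A) (sval S)) (g : scmorphism (sval B) (sval S)) :
  is_pullback (a : hom P A) (b : hom P B) (f : hom A S) (g : hom B S) <->
  [/\ forall e, f (a e) = g (b e),
      forall e e', a e = a e' -> b e = b e' -> e = e'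
    & forall i x y, 0 < i -> fil i x -> fil i y -> f x = g y ->
        exists e, [/\ fil i e, a e = x & b e = y]].
Proof.
split=> [[fg univ]|[fg inj surj]].
- pose Q : SCFp p :=
    SCFp_obj (fp_series_p_restricted (f := f) (g := g) (svalP A) (svalP B)).
  have [|w [[aw bw] _]] := univ Q (fp_fst f g) (fp_snd f g).
    by apply: scmorphism_eq => z; exact: fp_eq.
  have fgE e : f (a e) = g (b e).
    exact: hom_eqE fg e.
  have awE z : a (w z) = fp_fst f g z.
    exact: hom_eqE aw z.
  have bwE z : b (w z) = fp_snd f g z.
    exact: hom_eqE bw z.
  split=> // [e e' aee' bee'|i x y i0 xi yi xy]; last first.
    exists (w (fp_mk xy)); split; [|exact: awE|exact: bwE].
    by apply: scfun_fil => //; split.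
  pose c := fp_pair fgE.
  (* The identity and [w \oc c] have the same projections, and [c e0] depends only on [a e0] and
     [b e0]: joint injectivity follows. *)
  have wc e0 : w (c e0) = e0.
    have [v [_ vu]] := univ P a b fg.
    have vid : v = idm P by apply: vu; split; exact: scmorphism_eq.
    have vwc : v = (w : hom Q P) \oc (c : hom P Q).
      apply: vu; split; apply: scmorphism_eq => e1 /=.
        by rewrite awE.
      by rewrite bwE.
    exact: hom_eqE (etrans (esym vwc) vid) e0.
  rewrite -(wc e) -(wc e'); congr (w _).
  by apply: cs_val_inj; rewrite /= aee' bee'.
- split=> [|T u v uv]; first by apply: scmorphism_eq => e; exact: fg.
  have uvE t : f (u t) = g (v t).
    exact: hom_eqE uv t.
  have /choice[w wP] t : exists e, a e = u t /\ b e = v t.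
    have [e [_ ae be]] := surj _ _ _ (ltn0Sn 0) (filT (u t)) (filT (v t)) (uvE t).
    by exists e.
  have wM : {morph w : s t / s * t}.
    move=> s t; have [as_ bs] := wP s; have [at_ bt] := wP t.
    have [ast bst] := wP (s * t).
    by apply: inj; rewrite scfunM ?ast ?bst scfunM ?as_ ?at_ ?bs ?bt.
  have wF i : 0 < i -> forall t, fil i t -> fil i (w t).
    move=> i0 t ti; have [aw bw] := wP t.
    have [e [ei ae be]] := surj _ _ _ i0
      (scfun_fil u i0 ti) (scfun_fil v i0 ti) (uvE t).
    by rewrite (_ : w t = e)//; apply: inj; rewrite ?ae ?be.
  exists (SCMorphism wM wF); split.
    by split; apply: scmorphism_eq => t /=; have [] := wP t.
  move=> w' [aw' bw']; apply: scmorphism_eq => t.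
  have [aw bw] := wP t; apply: inj; rewrite ?aw ?bw /=.
    exact: esym (hom_eqE aw' t).
  exact: esym (hom_eqE bw' t).
Qed.

Lemma SCFp_has_pullbacks : has_pullbacks (SCFp p).
Proof.
move=> A B S f g.
pose Q : SCFp p :=
  SCFp_obj (fp_series_p_restricted (f := f) (g := g) (svalP A) (svalP B)).
exists Q, (fp_fst f g), (fp_snd f g); apply/(@pullbackP Q A B S); split.
- exact: fp_eq.
- move=> [[x y] z] [[x' y'] z'] /= xx' yy'.
  by apply: cs_val_inj; rewrite /= xx' yy'.
- by move=> i x y i0 xi yi xy; exists (fp_mk xy).
Qed.

(** Monicity is tested on the two projections of the kernel pair. *)
Lemma mono_inj (X Y : SCFp p) (k : hom X Y) :
  (forall (T : SCFp p) (u v : hom T X), k \oc u = k \oc v -> u = v) ->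
  injective (k : scmorphism (sval X) (sval Y)).
Proof.
move=> kmono x x' kxx'.
pose Q : SCFp p :=
  SCFp_obj (fp_series_p_restricted (f := k) (g := k) (svalP X) (svalP X)).
have : fp_fst k k = fp_snd k k :> hom Q X.
  by apply: kmono; apply: scmorphism_eq => z; exact: fp_eq.
by move=> /hom_eqE /(_ (fp_mk kxx')).
Qed.

Lemma kernelP (X Y Z : SCFp p)
    (k : scmorphism (sval X) (sval Y)) (q : scmorphism (sval Y) (sval Z)) :
  is_kernel (k : hom X Y) (q : hom Y Z) ->
  [/\ forall x, q (k x) = 1, injective k
    & forall i y, 0 < i -> fil i y -> q y = 1 -> exists2 x, fil i x & k x = y].
Proof.
move=> [qk univ].
have qk1 x : q (k x) = 1 by move/(@zero_morphismP p X Z): qk => /(_ x).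
split=> // [|i y i0 yi qy1].
- apply: (@mono_inj X Y) => T u v kuv.
  have [|w [_ wu]] := univ T (@Defs.comp (SCFp p) T X Y k u).
    by apply/(@zero_morphismP p T Z) => t; exact: qk1.
  by rewrite -(wu u erefl) (wu v (esym kuv)).
- pose e := sc_const1 triv_series (sval Z).
  (* This fibre product is the subgroup [q y = 1] with the filtration induced from [Y]; mapping it
     to [X] shows that a kernel carries the induced filtration. *)
  pose Q : SCFp p :=
    SCFp_obj (fp_series_p_restricted (f := q) (g := e) (svalP Y)
      (@triv_p_restricted p)).
  have [|u [ku _]] := univ Q (fp_fst q e).
    by apply/(@zero_morphismP p Q Z) => z; exact: (fp_eq z).
  exists (u (fp_mk (qy1 : q y = e 1))); last exact: hom_eqE ku _.
  by apply: scfun_fil => //; split.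
Qed.

(** Stronger than surjectivity of the group morphism: [H] carries the quotient filtration. *)
Definition filtered_surjective (G H : scseries) (q : scmorphism G H) :=
  forall i z, 0 < i -> fil i z -> exists2 y, fil i y & q y = z.

Lemma filtered_surjective_factor (X Y T : SCFp p) (q : hom X Y) (u : hom X T) :
  filtered_surjective (q : scmorphism (sval X) (sval Y)) ->
  (forall x x' : sval X, (q : scmorphism (sval X) (sval Y)) x =
     (q : scmorphism (sval X) (sval Y)) x' ->
     (u : scmorphism (sval X) (sval T)) x =
     (u : scmorphism (sval X) (sval T)) x') ->
  exists! v : hom Y T, v \oc q = u.
Proof.
move: q u => /= q u qs uq.
have /choice[v vP] y : exists t, forall x, q x = y -> t = u x.
  have [x _ <-] := qs _ _ (ltn0Sn 0) (filT y).
  by exists (u x) => x' xx'; apply: uq.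
have vq x : v (q x) = u x by exact: vP.
have vM : {morph v : y z / y * z}.
  move=> y z; have [x _ <-] := qs _ _ (ltn0Sn 0) (filT y).
  have [x' _ <-] := qs _ _ (ltn0Sn 0) (filT z).
  by rewrite -scfunM !vq scfunM.
have vF i : 0 < i -> forall y, fil i y -> fil i (v y).
  move=> i0 y yi; have [x xi <-] := qs _ _ i0 yi.
  by rewrite vq; exact: scfun_fil.
exists (SCMorphism vM vF); split; first by apply: scmorphism_eq.
move=> v' v'q; apply: scmorphism_eq => y /=.
have [x _ <-] := qs _ _ (ltn0Sn 0) (filT y).
by rewrite vq -(hom_eqE v'q x).
Qed.

Lemma im_proj_surjective (G H : scseries) (f : scmorphism G H) :
  filtered_surjective (im_proj f).
Proof.
move=> i [y y1] i0 [x xi /= xy]; exists x => //.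
exact: cs_val_inj.
Qed.

(** Since [im_proj q] also coequalizes the pair, it factors through [q] by a filtered section [v] of
    [im_incl q], whence degreewise preimages. Conversely, [q] is the coequalizer of its kernel
    pair. *)
Lemma regular_epiP (Y Z : SCFp p) (q : scmorphism (sval Y) (sval Z)) :
  is_regular_epi (q : hom Y Z) <-> filtered_surjective q.
Proof.
split=> [[X [f [g [fg univ]]]]|qs].
- pose I : SCFp p := SCFp_obj (im_series_p_restricted (f := q) (svalP Y)).
  have [|v [vq _]] := univ I (im_proj q).
    by apply: scmorphism_eq => x; apply: cs_val_inj; exact: hom_eqE fg x.
  have iv z : im_incl q (v z) = z.
    have [w [_ wu]] := univ Z q fg.
    have widm : w = idm Z by apply: wu; exact: comp_idl.
    have wiv : w = @Defs.comp (SCFp p) Z I Z (im_incl q) v.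
      apply: wu; apply: scmorphism_eq => y.
      exact: (congr1 (im_incl q) (hom_eqE vq y)).
    exact: hom_eqE (etrans (esym wiv) widm) z.
  move=> i z i0 /(scfun_fil v i0) [y yi yz]; exists y => //.
  by rewrite yz; exact: iv.
- pose Q : SCFp p :=
    SCFp_obj (fp_series_p_restricted (f := q) (g := q) (svalP Y) (svalP Y)).
  exists Q, (fp_fst q q), (fp_snd q q); split=> [|T u uq].
    by apply: scmorphism_eq => z; exact: fp_eq.
  apply: (@filtered_surjective_factor Y Z T) => // x x' xx'.
  exact: (hom_eqE uq (fp_mk xx')).
Qed.

Lemma SCFp_regular : regular (SCFp p).
Proof.
split.
- by exists (SCFp_obj (@triv_p_restricted p)); exact: (triv_zero_object p).2.
- exact: SCFp_has_pullbacks.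
- move=> P X Y f a b /(@pullbackP P X X Y)[fab _ absurj].
  pose I : SCFp p := SCFp_obj (im_series_p_restricted (f := f) (svalP X)).
  exists I, (im_proj f); split=> [|T u uab].
    by apply: scmorphism_eq => e; apply: cs_val_inj; exact: fab.
  apply: (@filtered_surjective_factor X I T); first exact: im_proj_surjective.
  move=> x x' /(congr1 (@cs_val _ _ _)) /= xx'.
  have [e [_ <- <-]] := absurj _ _ _ (ltn0Sn 0) (filT x) (filT x') xx'.
  exact: (hom_eqE uab e).
- move=> P A B S a b f g /(@pullbackP P A B S)[_ _ absurj].
  move=> /(@regular_epiP A S) fs; apply/(@regular_epiP P B) => i y i0 yi.
  have [x xi xy] := fs _ _ i0 (scfun_fil g i0 yi).
  by have [e [ei _ <-]] := absurj _ _ _ i0 xi yi xy; exists e.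
Qed.

Lemma SCFp_isoP (X Y : SCFp p) (f : scmorphism (sval X) (sval Y)) :
  is_iso (f : hom X Y) <-> injective f /\ filtered_surjective f.
Proof.
split=> [[g [gf fg]]|[finj fs]].
- split=> [|i y i0 yi].
    by apply: (can_inj (g := g)) => x; exact: hom_eqE gf x.
  by exists (g y); [exact: scfun_fil | exact: hom_eqE fg y].
- have [g [gf _]] := @filtered_surjective_factor X Y X f (idm X) fs finj.
  exists g; split=> //; apply: scmorphism_eq => y.
  have [x _ <-] := fs _ _ (ltn0Sn 0) (filT y).
  exact: (congr1 f (hom_eqE gf x)).
Qed.

(** A filtered form of the split short five lemma. *)
Lemma SCFp_protomodular : protomodular (SCFp p).
Proof.
move=> B B' v A1 p1 s1 A2 p2 s2 h A1' a1 p1' A2' a2 p2' h'.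
move=> ps1 ps2 ph hs /(@pullbackP A1' A1 B' B)[pa1 inj1 surj1].
move=> /(@pullbackP A2' A2 B' B)[pa2 inj2 surj2] ah ph'.
move=> /(@SCFp_isoP A1' A2')[h'inj h's]; apply/(@SCFp_isoP A1 A2).
have {}ph x : p2 (h x) = p1 x by exact: (hom_eqE ph x).
have {}ah e : a2 (h' e) = h (a1 e) by exact: (hom_eqE ah e).
have {}ph' e : p2' (h' e) = p1' e by exact: (hom_eqE ph' e).
have {}hs b : h (s1 b) = s2 b by exact: (hom_eqE hs b).
have {}ps2 b : p2 (s2 b) = b by exact: (hom_eqE ps2 b).
(* An element killed by [h] lies over [1 = v 1], so it lifts to [A1'] over 1, where [h'] is
   injective. *)
have hker x : h x = 1 -> x = 1.
  move=> hx1; have px1 : p1 x = v 1 by rewrite -ph hx1 !scfun1.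
  have [e [_ ax ep1]] := surj1 _ _ _ (ltn0Sn 0) (filT x) (filT 1) px1.
  suff e1 : e = 1 by rewrite -ax e1 scfun1.
  by apply/h'inj/inj2; rewrite ?ah ?ph' ?ax ?ep1 ?hx1 !scfun1.
split=> [x x' hxx'|i y i0 yi].
  apply: (mulIg x'^-1); rewrite mulgV; apply: hker.
  by rewrite scfunM scfunV hxx' mulgV.
(* Removing the section part of [y] leaves an element over 1 of the same degree, which lifts to
   [A2'] and then through [h'] to [A1']. *)
pose n := y * (s2 (p2 y))^-1.
have ni : fil i n.
  by apply: fil_M => //; apply: fil_V => //; do 2 apply: scfun_fil => //.
have pn1 : p2 n = v 1 by rewrite /n scfunM scfunV ps2 mulgV scfun1.
have [e2 [e2i ae2 _]] := surj2 _ _ _ i0 ni (fil_1 _ i0) pn1.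
have [e1 e1i he] := h's _ _ i0 e2i.
exists (a1 e1 * s1 (p2 y)).
  by apply: fil_M => //; do ?apply: scfun_fil => //.
by rewrite scfunM hs -ah he ae2 /n mulgVK.
Qed.

Lemma SCFp_homological : homological (SCFp p).
Proof.
split; [|exact: SCFp_regular|exact: SCFp_protomodular].
by exists (SCFp_obj (@triv_p_restricted p)); exact: triv_zero_object.
Qed.

End SCFp.

(** * The canonical action *)

Section SplitExtension.
Variables (G Y Z : scseries).
Variables (k : scmorphism G Y) (q : scmorphism Y Z) (s : scmorphism Z Y).
Hypothesis qs : forall z, q (s z) = z.
Hypothesis qk : forall g, q (k g) = 1.
Hypothesis kinj : injective k.
Hypothesis ksurj : forall i y, 0 < i -> fil i y -> q y = 1 ->
  exists2 g, fil i g & k g = y.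

Let ker_ex y : exists g, q y = 1 -> k g = y.
Proof.
(* The value 1 outside the kernel is an arbitrary default. *)
have [qy1|qy1] := pselect (q y = 1); last by exists 1 => /qy1.
by have [g _ gy] := ksurj (ltn0Sn 0) (filT y) qy1; exists g.
Qed.

Definition ker_inv (y : Y) : G := sval (cid (ker_ex y)).

Lemma ker_invK y : q y = 1 -> k (ker_inv y) = y.
Proof. exact: svalP (cid (ker_ex y)). Qed.

Lemma ker_fil i g : 0 < i -> fil i (k g) -> fil i g.
Proof. by move=> i0 ki; have [g' ? /kinj <-] := ksurj i0 ki (qk g). Qed.

Lemma ker_inv_fil i y : 0 < i -> q y = 1 -> fil i y -> fil i (ker_inv y).
Proof. by move=> i0 qy1 yi; apply: ker_fil => //; rewrite ker_invK. Qed.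

(** As [x ^ y] is [y^-1 * x * y], the inverse makes this a left action. *)
Definition conj_fun (z : Z) (g : G) : G := ker_inv (k g ^ (s z)^-1).

Lemma conj_funE z g : k (conj_fun z g) = k g ^ (s z)^-1.
Proof.
apply: ker_invK.
by rewrite conjgE !(scfunM, scfunV) qk mul1g mulVg.
Qed.

Lemma conj_funM z : {morph conj_fun z : g h / g * h}.
Proof.
by move=> g h; apply: kinj; rewrite conj_funE !scfunM !conj_funE conjMg.
Qed.

Lemma conj_fun_mul z w g : conj_fun (z * w) g = conj_fun z (conj_fun w g).
Proof. by apply: kinj; rewrite !conj_funE scfunM invgM conjgM. Qed.

Lemma conj_fun1 g : conj_fun 1 g = g.
Proof. by apply: kinj; rewrite conj_funE scfun1 invg1 conjg1. Qed.

Lemma conj_fun_fil z i g : 0 < i -> fil i g -> fil i (conj_fun z g).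
Proof.
move=> i0 gi; apply: ker_fil => //; rewrite conj_funE.
by apply: fil_J => //; exact: scfun_fil.
Qed.

Lemma conj_funK z : cancel (conj_fun z) (conj_fun z^-1).
Proof. by move=> g; rewrite -conj_fun_mul mulVg conj_fun1. Qed.

Lemma conj_funKV z : cancel (conj_fun z^-1) (conj_fun z).
Proof. by move=> g; rewrite -conj_fun_mul mulgV conj_fun1. Qed.

Definition conj_aut (z : Z) : filtered_aut G.
Proof.
exists (conj_fun z); first exact: conj_funM.
  by exists (conj_fun z^-1); [exact: conj_funK | exact: conj_funKV].
move=> i i0; apply/seteqP; split=> [_ [g gi <-]|g gi].
  exact: conj_fun_fil.
by exists (conj_fun z^-1 g); [exact: conj_fun_fil | exact: conj_funKV].
Defined.

(** The image under [k] of the element to be bounded is a commutator in [Y], of degree [i + j], and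
    [ker_fil] brings this degree back to [G]. *)
Lemma conj_aut_Afil j z : 0 < j -> fil j z -> Afil j (conj_aut z).
Proof.
move=> j0 zj i i0 g gi; rewrite [aut_fun _ _]/(conj_fun z g).
apply: ker_fil; first by rewrite addn_gt0 i0.
rewrite scfunM scfunV conj_funE.
have -> : k g ^ (s z)^-1 * (k g)^-1 = [~ (s z)^-1, (k g)^-1].
  by rewrite /commg /conjg !invgK !mulgA.
rewrite addnC; apply: fil_commg => //; apply: fil_V => //; exact: scfun_fil.
Qed.

Definition conj_morphism : scmorphism Z (A_series G).
Proof.
exists (fun z => A1Type (conj_aut_Afil (ltn0Sn 0) (filT z)) : A_series G).
- move=> z w; apply/A1_val_inj/filtered_aut_eq => g; exact: conj_fun_mul.
- by move=> i i0 z zi; exact: conj_aut_Afil.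
Defined.

Let ker_part y : q (y * (s (q y))^-1) = 1.
Proof. by rewrite scfunM scfunV qs mulgV. Qed.

(** Every [y] is uniquely [k g * s z] with [z = q y]; here [z] is replaced by the automorphism that
    it induces. *)
Definition split_fun (y : Y) : semidirect G :=
  SD (ker_inv (y * (s (q y))^-1)) (conj_morphism (q y)).

Definition split_morphism : scmorphism Y (semidirect G).
Proof.
exists split_fun => [x y|i i0 y yi].
- rewrite /split_fun !(scfunM q) (scfunM conj_morphism).
  congr SD; apply: kinj.
  transitivity (k (ker_inv (x * (s (q x))^-1) *
                   conj_fun (q x) (ker_inv (y * (s (q y))^-1)))) => //.
  rewrite [RHS]scfunM conj_funE -(scfunM q) !ker_invK// conjgE invgK !scfunM.
  by rewrite invgM !mulgA mulgVK.
- split; last by do 2 apply: scfun_fil => //.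
  apply: ker_inv_fil => //; apply: fil_M => //; apply: fil_V => //.
  by do 2 apply: scfun_fil => //.
Defined.

Lemma split_morphism_sec z : split_morphism (s z) = can_sec G (conj_morphism z).
Proof.
congr SD; last by rewrite qs.
by apply: kinj; rewrite ker_invK ?qs ?mulgV ?scfun1.
Qed.

Lemma split_morphism_ker g : split_morphism (k g) = can_ker G g.
Proof.
congr SD; last by rewrite qk scfun1.
by apply: kinj; rewrite ker_invK ?qk ?scfun1 ?invg1 ?mulg1.
Qed.

Lemma split_morphism_inj x y : split_morphism x = split_morphism y ->
  q x = q y -> x = y.
Proof.
move=> [/(congr1 k)]; rewrite !ker_invK// => xy _ qxy.
by apply: (mulIg (s (q x))^-1); rewrite xy qxy.
Qed.

Lemma split_morphism_surj i (x : semidirect G) z : 0 < i ->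
  fil i x -> fil i z -> sd_r x = conj_morphism z ->
  exists y, [/\ fil i y, split_morphism y = x & q y = z].
Proof.
move=> i0 [xl xr] zi xz.
have qy : q (k (sd_l x) * s z) = z by rewrite scfunM qk qs mul1g.
exists (k (sd_l x) * s z); split=> //.
  by apply: fil_M => //; exact: scfun_fil.
rewrite [LHS]/(split_fun _) /split_fun qy mulgK.
case: x {xl xr qy} xz => l r /= ->; congr SD.
by apply: kinj; rewrite ker_invK.
Qed.

Lemma conj_morphism_unique (f : scmorphism Z (A_series G))
    (h : scmorphism Y (semidirect G)) :
  (forall z, h (s z) = can_sec G (f z)) -> (forall g, h (k g) = can_ker G g) ->
  conj_morphism = f.
Proof.
move=> hs hk; apply: scmorphism_eq => z.
apply/A1_val_inj/filtered_aut_eq => g.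
(* This relation of [Y] is carried by [h] into the semidirect product, where its first components
   read [conj_fun z g = f z g]. *)
have : h (k (conj_fun z g) * s z) = h (s z * k g).
  by rewrite conj_funE conjgE invgK !mulgA mulgVK.
rewrite !scfunM !hk !hs => /(congr1 (@sd_l G)) /=.
by rewrite mulg1 mul1g.
Qed.

End SplitExtension.

(** * Universality of the canonical action *)

Section Universal.
Variables (p : nat) (G : SCFp p).
Hypothesis hA : p_restricted p (A_series (sval G)).
Hypothesis hS : p_restricted p (semidirect (sval G)).

Lemma canonical_action_universal (Z : SCFp p) (E : action Z G) :
  exists! f : hom Z (SCFp_obj hA), is_restriction f (canonical_action hA hS) E.
Proof.
case: E => Y k q s sq kP.
have [qk kinj ksurj] := @kernelP p G Y Z k q kP.
have qs z : (q : scmorphism _ _) ((s : scmorphism _ _) z) = z := hom_eqE sq z.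
exists (conj_morphism s qk kinj ksurj); split.
  exists (split_morphism qs qk kinj ksurj); split.
  - apply/(@pullbackP p Y (SCFp_obj hS) Z (SCFp_obj hA)); split=> //.
    + exact: split_morphism_inj.
    + move=> i x z; exact: split_morphism_surj.
  - by apply: scmorphism_eq => z; exact: split_morphism_sec.
  - by apply: scmorphism_eq => g; exact: split_morphism_ker.
move=> f [h [_ hs hk]].
apply: (@conj_morphism_unique _ _ _ k q s qk kinj ksurj f h) => [z|g].
  exact: hom_eqE hs z.
exact: hom_eqE hk g.
Qed.

End Universal.

Theorem corollary3p12 (p : nat) (hp : prime p) :
  action_representative (SCFp p) /\
  forall G : SCFp p,
    exists (hA : p_restricted p (A_series (sval G)))
           (hS : p_restricted p (semidirect (sval G))),
      universal_action (canonical_action hA hS).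
Proof.
have U (G : SCFp p) : exists (hA : p_restricted p (A_series (sval G)))
    (hS : p_restricted p (semidirect (sval G))),
    universal_action (canonical_action hA hS).
  have hA := A_series_p_restricted hp (svalP G).
  have hS := semidirect_p_restricted hp (svalP G).
  exists hA, hS; split; last exact: canonical_action_universal.
  have [C0 _ _] := SCFp_homological p.
  apply: (universal_represents (U := canonical_action hA hS) C0).
  - exact: SCFp_has_pullbacks.
  - exact: canonical_action_universal.
split=> //; split; first exact: SCFp_homological.
by move=> G; have [hA [hS [R _]]] := U G; exists (SCFp_obj hA).
Qed.
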